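(* Let $s\ge 2$ and let $w$ be a nonempty word over $\Sigma_s$ such that $\mathcal{G}(w)$ is connected. Then the diameter of $\mathcal{G}(w)$ is at most $3s-3$.
   Context: $\Sigma_s$ denotes the ordered alphabet $\{a_1<a_2<\dots<a_s\}$. For a nonempty word $w=w_1\cdots w_n$ over $\Sigma_s$, the Parikh graph $\mathcal{G}(w)$ is the simple undirected graph on $\{1,\dots,n\}$ where, for $i<j$, $i$ and $j$ are adjacent iff $w_i=a_k$ and $w_j=a_{k+1}$ for some $1\le k\le s-1$. *)

(* Defs.v *)
From mathcomp Require Import all_boot.

Set Implicit Arguments.
Unset Strict Implicit.
Unset Printing Implicit Defensive.

Section GraphDistance.

Variables (T : finType) (e : rel T).

Definition has_walk (k : nat) (x y : T) : bool :=
  [exists p : k.-tuple T, path e x p && (last x p == y)].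

(* The least length of a walk from x to y.  A shortest walk has fewer than
   #|T| edges, so the search is exhaustive; the value is #|T| when no walk
   exists, which does not occur in a connected graph. *)
Definition gdist (x y : T) : nat :=
  find (fun k => has_walk k x y) (iota 0 #|T|).

Definition diameter : nat := \max_(x : T) \max_(y : T) gdist x y.

(* Only meaningful on a nonempty vertex type. *)
Definition connected_graph : Prop := forall x y : T, connect e x y.

Lemma has_walkP k x y :
  reflect (exists p : seq T, [/\ size p = k, path e x p & last x p = y])
          (has_walk k x y).
Proof.
apply: (iffP existsP) => [[p /andP[ep /eqP lp]]|[p [sp ep lp]]].
  by exists p; rewrite size_tuple.
by exists (Tuple (introT eqP sp)); rewrite /= ep lp eqxx.
Qed.

Lemma gdist_walk x y : connect e x y -> has_walk (gdist x y) x y.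
Proof.
case/connectP=> p0 ep0 ->; case/shortenP: ep0 => p ep up _.
set z := last x p.
have lt_p : size p < #|T| by rewrite -[_.+1](card_uniqP up) max_card.
have hz : has (fun k => has_walk k x z) (iota 0 #|T|).
  apply/hasP; exists (size p); first by rewrite mem_iota.
  by apply/has_walkP; exists p.
have := nth_find 0 hz; rewrite nth_iota ?add0n //.
by rewrite -[X in _ < X](size_iota 0) -has_find.
Qed.

Lemma gdist_min x y (p : seq T) :
  path e x p -> last x p = y -> gdist x y <= size p.
Proof.
move=> ep lp; rewrite leqNgt; apply/negP => lt_p.
have := before_find 0 lt_p.
have lt_T : size p < #|T|.
  by apply: leq_trans lt_p _; rewrite -[leqRHS](size_iota 0) find_size.
by rewrite nth_iota // add0n => /has_walkP[]; exists p.
Qed.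

End GraphDistance.

(* Letter a_{k+1} of the alphabet {a_1 < ... < a_s} is the ordinal k : 'I_s,
   and position i+1 of the word is the vertex i : 'I_n. *)
Section ParikhGraph.

Variables (s n : nat) (w : n.-tuple 'I_s).

Definition parikh_arc (i j : 'I_n) : bool :=
  (i < j) && (tnth w j == (tnth w i).+1 :> nat).

Definition parikh_graph : rel 'I_n :=
  fun i j => parikh_arc i j || parikh_arc j i.

Lemma parikh_graph_sym : symmetric parikh_graph.
Proof. by move=> i j; rewrite /parikh_graph orbC. Qed.

Lemma parikh_graph_irr : irreflexive parikh_graph.
Proof. by move=> i; rewrite /parikh_graph /parikh_arc ltnn. Qed.

End ParikhGraph.

(* Main.v *)
Require Import Defs.
From mathcomp Require Import all_boot zify.

Set Implicit Arguments.
Unset Strict Implicit.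
Unset Printing Implicit Defensive.

(** An edge of the graph joins letters [a_k] and [a_{k+1}] for a unique [k]:
    call [k] its level.  Two edges of the same level never form an induced
    [2K_2]: from [a < b] and [a' < b'] one gets [a < b'] or [a' < b].  Since a
    geodesic has no chords, two of its edges of the same level are at most two
    steps apart, so each of the [s - 1] levels accounts for at most three edges
    of a geodesic. *)

(** A chord would bypass the vertices strictly between its ends and give a walk shorter than the
    distance. *)
Lemma gdist_edge_le (T : finType) (e : rel T) (x y : T) (p : seq T) i j :
  path e x p -> last x p = y -> size p = gdist e x y ->
  i < j <= size p -> e (nth x (x :: p) i) (nth x (x :: p) j) -> j <= i.+1.
Proof.
(* After this shift the far end of the chord, vertex [j.+1] of [x :: p], is the head of
   [drop j p]. *)
case: j => // j ep lp sp /andP[lt_ij le_jp] eij.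
have lt_ip : i < size p by apply: leq_trans le_jp.
have last_i : last x (take i p) = nth x (x :: p) i.
  by rewrite (last_nth x) (size_takel (ltnW lt_ip)) -[x :: take i p]/(take i.+1 (x :: p)) nth_take.
have drop_j : drop j p = nth x p j :: drop j.+1 p by rewrite (drop_nth x).
have ep' : path e x (take i p ++ drop j p).
  have /andP[ep_i _] : path e x (take i p) && path e (last x (take i p)) (drop i p).
    by rewrite -cat_path cat_take_drop.
  have : path e x (take j p) && path e (last x (take j p)) (drop j p).
    by rewrite -cat_path cat_take_drop.
  rewrite drop_j => /and3P[_ _ ep_j].
  by rewrite cat_path ep_i last_i; apply: (introT andP (conj eij ep_j)).
have lp' : last x (take i p ++ drop j p) = y.
  by rewrite -lp -[in RHS](cat_take_drop j p) !last_cat drop_j.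
have := gdist_min ep' lp'.
by rewrite -sp size_cat (size_takel (ltnW lt_ip)) size_drop; lia.
Qed.

(** A geodesic may traverse an arc in either direction; [a] and [b] index its lower and upper ends,
    and the level is the letter at [a]. *)
Lemma parikh_edge_level (s n : nat) (w : n.-tuple 'I_s) (v : nat -> 'I_n) i :
  parikh_graph w (v i) (v i.+1) ->
  exists a b, [/\ i <= a <= i.+1, i <= b <= i.+1, parikh_arc w (v a) (v b)
    & minn (tnth w (v i)) (tnth w (v i.+1)) = tnth w (v a)].
Proof.
case/orP=> arc; [exists i, i.+1 | exists i.+1, i]; rewrite !leqnn leqnSn.
  by split=> //; case/andP: arc => _ /eqP->; apply/minn_idPl.
by split=> //; case/andP: arc => _ /eqP->; apply/minn_idPr.
Qed.

(** If [b' <= a], then [a' < b' <= a < b]. *)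
Lemma parikh_arc_cross (s n : nat) (w : n.-tuple 'I_s) (a b a' b' : 'I_n) :
  parikh_arc w a b -> parikh_arc w a' b' -> tnth w a = tnth w a' :> nat ->
  parikh_arc w a b' || parikh_arc w a' b.
Proof.
rewrite /parikh_arc => /andP[ab /eqP->] /andP[ab' /eqP->] ->.
by rewrite eqxx !andbT; lia.
Qed.

Lemma parikh_gdist_le (s n : nat) (w : n.-tuple 'I_s) (x y : 'I_n) :
  2 <= s -> connect (parikh_graph w) x y ->
  gdist (parikh_graph w) x y <= s.-1 * 3.
Proof.
(* With [s = r.+2] the levels form ['I_r.+1], visibly nonempty as [inord] requires. *)
case: s w => [|[|r]] // w _ /gdist_walk /has_walkP[p [sp ep lp]].
pose v := nth x (x :: p).
pose level i := minn (tnth w (v i)) (tnth w (v i.+1)).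
have edge i : i < size p -> parikh_graph w (v i) (v i.+1).
  by move=> lt_ip; apply: (pathP x ep).
have level_lt i : i < size p -> level i < r.+1.
  move=> /edge; rewrite /level /parikh_graph /parikh_arc.
  have := ltn_ord (tnth w (v i)); have := ltn_ord (tnth w (v i.+1)).
  by move=> ? ? /orP[] /andP[_ /eqP]; lia.
have near i j : i < j < size p -> level i = level j -> j <= i.+2.
  case/andP=> lt_ij lt_jp; rewrite /level.
  have [a [b [ha hb ab ->]]] := parikh_edge_level (edge i (ltn_trans lt_ij lt_jp)).
  have [a' [b' [ha' hb' ab' ->]]] := parikh_edge_level (edge j lt_jp).
  (* Now [a, b <= i.+1] and [a', b' >= i.+3], so either crossing arc is a chord spanning at least
     two steps. *)
  move=> eq_aa'; rewrite leqNgt; apply/negP => far.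
  case/orP: (parikh_arc_cross ab ab' eq_aa') => arc.
    have : b' <= a.+1; last by lia.
    by apply: (gdist_edge_le ep lp sp); [lia | rewrite /parikh_graph arc].
  have : a' <= b.+1; last by lia.
  by apply: (gdist_edge_le ep lp sp); [lia | rewrite /parikh_graph arc orbT].
(* Edges of equal level are at most two steps apart, so the level together with
   the index modulo 3 determines an edge of the geodesic. *)
pose f (i : 'I_(size p)) : 'I_r.+1 * 'I_3 := (inord (level i), inord (i %% 3)).
have f_inj : injective f.
  move=> i j [/(congr1 val) /= eq_level /(congr1 val) /= eq_mod].
  rewrite !inordK ?level_lt // in eq_level.
  rewrite !inordK ?ltn_pmod // in eq_mod.
  have near_ij : i < j -> j <= i.+2.
    by move=> lt_ij; apply: near eq_level; rewrite lt_ij ltn_ord.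
  have near_ji : j < i -> i <= j.+2.
    by move=> lt_ji; apply: near (esym eq_level); rewrite lt_ji ltn_ord.
  apply: ord_inj; move: near_ij near_ji eq_mod; clear.
  by move: (nat_of_ord i) (nat_of_ord j) => a b; lia.
by rewrite -sp -[size p]card_ord (leq_trans (leq_card f f_inj)) // card_prod !card_ord.
Qed.

Theorem theorem5p5 (s n : nat) (w : n.-tuple 'I_s)
    (hs : 2 <= s) (hn : 0 < n)
    (hconn : connected_graph (parikh_graph w)) :
  diameter (parikh_graph w) <= 3 * s - 3.
Proof.
apply/bigmax_leqP => x _; apply/bigmax_leqP => y _.
by apply: leq_trans (parikh_gdist_le hs (hconn x y)) _; lia.
Qed.
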